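(* Let $\alpha,\beta>0$. For every $L\ge1$, the partition function $Z_L$ of the asymmetric annihilation process on $L$ sites (the sum of the entries of the vector $|v_L\rangle$ defined in the context) is $$Z_L=2^{\binom{L-1}{2}}(1+2\alpha)^{L-1}(1+\beta)^{L-1}(2\alpha+\beta).$$
   Context: The model: a continuous-time Markov chain on configurations $\eta=(\eta_1,\dots,\eta_L)\in\{0,1\}^L$, with parameters $\alpha,\beta>0$ and the following transitions. Bulk: for each pair of neighbouring sites $(i,i+1)$, $1\le i\le L-1$, $10\to 01$ with rate $1$ and $11\to 00$ with rate $1$. Left boundary: at site $1$, $0\to 1$ with rate $\alpha$ and $1\to 0$ with rate $\alpha$. Right boundary: at site $L$, $1\to0$ with rate $\beta$. Its Markov matrix $M_L$ is indexed by binary words of length $L$ in increasing order, with $(i,j)$ entry ($i\neq j$) the rate from configuration $j$ to configuration $i$, and columns summing to zero. Notation: $\sigma=\begin{pmatrix}0&1\\ 1&0\end{pmatrix}$; $\mathbb{1}_K$ is the identity matrix of size $2^K$ (so $\mathbb{1}_0=(1)$); $\otimes$ is the Kronecker product. Transfer matrices: the $2^{L+1}\times2^L$ matrices $T_{L,L+1}=\begin{pmatrix} T_1^{(L)} \\ T_2^{(L)} \end{pmatrix}$ (blocks of size $2^L\times 2^L$) are defined recursively by $$T_1^{(1)}=\begin{pmatrix}1+\beta+\alpha\beta & \alpha+\beta+\alpha\beta\\ \alpha & 1\end{pmatrix},\qquad T_2^{(1)}=\begin{pmatrix}\alpha+\alpha\beta & \alpha\beta\\ 0&\alpha\end{pmatrix},$$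 and for $L\ge2$ $$T_1^{(L)}=\begin{pmatrix} T_1^{(L-1)}+\frac1\alpha T_2^{(L-1)} & 2T_2^{(L-1)}+\frac1\alpha T_2^{(L-1)}(\sigma\otimes \mathbb{1}_{L-2})\\[2pt] T_2^{(L-1)} & \frac1\alpha T_2^{(L-1)}\end{pmatrix},\qquad T_2^{(L)}=\begin{pmatrix}2T_2^{(L-1)} & T_2^{(L-1)}(\sigma\otimes \mathbb{1}_{L-2})\\[2pt] 0& T_2^{(L-1)}\end{pmatrix}.$$ They satisfy $M_{L+1}T_{L,L+1}=T_{L,L+1}M_L$. The vectors $|v_L\rangle\in\mathbb{R}^{2^L}$ are defined by $|v_1\rangle=\begin{pmatrix}\alpha+\beta\\ \alpha\end{pmatrix}$ and $|v_{L+1}\rangle=T_{L,L+1}|v_L\rangle$; thus $M_L|v_L\rangle=0$, and the stationary probability vector is $|v_L\rangle/Z_L$, where $Z_L$, the partition function, is the sum of all entries of $|v_L\rangle$. *)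

(* Defs.v *)
From mathcomp Require Import all_boot all_order all_algebra.
From mathcomp Require Import mxtens.

Set Implicit Arguments.
Unset Strict Implicit.
Unset Printing Implicit Defensive.

Import Order.TTheory GRing.Theory Num.Theory.
Local Open Scope ring_scope.

(* 2 ^ K, written so that [pow2 K.+1] is convertible to [pow2 K + pow2 K]:
   block matrices then have the right type without a cast.  *)
Fixpoint pow2 (K : nat) : nat :=
  if K is K'.+1 then (pow2 K' + pow2 K')%N else 1%N.

Lemma pow2E (K : nat) : pow2 K = (2 ^ K)%N.
Proof. by elim: K => //= K ->; rewrite addnn -mul2n -expnS. Qed.

Lemma mul2_pow2 (K : nat) : (2 * pow2 K)%N = pow2 K.+1.
Proof. by rewrite mul2n -addnn. Qed.

Section AnnihilationProcess.

Variable R : realFieldType.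

Definition mx22 (a b c d : R) : 'M[R]_2 :=
  block_mx (a%:M : 'M_1) (b%:M : 'M_1) (c%:M : 'M_1) (d%:M : 'M_1).

Definition sigma : 'M[R]_2 := mx22 0 1 1 0.

Definition sigma_tens1 (K : nat) : 'M[R]_(pow2 K.+1) :=
  castmx (mul2_pow2 K, mul2_pow2 K) (tensmx sigma (1%:M : 'M[R]_(pow2 K))).

Variables alpha beta : R.

(* The pair (T_1^(L), T_2^(L)); the value at L = 0 is a dummy.  In the
   recursive case L = K.+2, so that sigma is tensored with the identity of
   size 2 ^ K = 2 ^ (L - 2).  *)
Fixpoint transfer_blocks (L : nat) : 'M[R]_(pow2 L) * 'M[R]_(pow2 L) :=
  match L with
  | 0 => (0, 0)
  | L'.+1 =>
    match L' return
      'M[R]_(pow2 L') * 'M[R]_(pow2 L') ->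
      'M[R]_(pow2 L'.+1) * 'M[R]_(pow2 L'.+1) with
    | 0 => fun=>
        (mx22 (1 + beta + alpha * beta) (alpha + beta + alpha * beta)
              alpha                     1,
         mx22 (alpha + alpha * beta) (alpha * beta)
              0                      alpha)
    | K.+1 => fun T =>
        let T1 := T.1 in let T2 := T.2 in
        (block_mx (T1 + alpha^-1 *: T2)
                  (2 *: T2 + alpha^-1 *: (T2 *m sigma_tens1 K))
                  T2
                  (alpha^-1 *: T2),
         block_mx (2 *: T2) (T2 *m sigma_tens1 K)
                  0         T2)
    end (transfer_blocks L')
  end.

Definition transfer (L : nat) : 'M[R]_(pow2 L.+1, pow2 L) :=
  col_mx (transfer_blocks L).1 (transfer_blocks L).2.

(* |v_L>; the value at L = 0 is a dummy.  *)
Fixpoint vstat (L : nat) : 'cV[R]_(pow2 L) :=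
  match L with
  | 0 => 0
  | L'.+1 =>
    match L' return 'cV[R]_(pow2 L') -> 'cV[R]_(pow2 L'.+1) with
    | 0 => fun=> col_mx (alpha + beta)%:M alpha%:M
    | K.+1 => fun v => transfer K.+1 *m v
    end (vstat L')
  end.

Definition partition_function (L : nat) : R := \sum_i vstat L i 0.

End AnnihilationProcess.

(* Main.v *)
Require Import Defs.
From mathcomp Require Import all_boot all_order all_algebra.
From mathcomp Require Import mxtens ring.

Set Implicit Arguments.
Unset Strict Implicit.
Unset Printing Implicit Defensive.

Import Order.TTheory GRing.Theory Num.Theory.
Local Open Scope ring_scope.

(** All column sums of the transfer matrix T_{L,L+1} are equal to
    2^(L-1) (1 + 2 alpha) (1 + beta), so passing from v_L to v_{L+1} multiplies
    the sum of the entries by this number.  Column sums of the blocks T_1 and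
    T_2 are separately constant: a constant row vector is unchanged under right
    multiplication by sigma (x) 1, so constancy propagates along the recursion. *)

Lemma mul_const_block (R : pzSemiRingType) (m1 m2 n1 n2 : nat)
    (A : 'M[R]_(m1, n1)) (B : 'M[R]_(m1, n2))
    (C : 'M[R]_(m2, n1)) (D : 'M[R]_(m2, n2)) (x a b c d y : R) :
  const_mx x *m A = const_mx a :> 'rV_n1 ->
  const_mx x *m B = const_mx b :> 'rV_n2 ->
  const_mx x *m C = const_mx c :> 'rV_n1 ->
  const_mx x *m D = const_mx d :> 'rV_n2 ->
  a + c = y -> b + d = y ->
  const_mx x *m block_mx A B C D = const_mx y :> 'rV_(n1 + n2).
Proof.
move=> EA EB EC ED acE bdE; rewrite -row_mx_const mul_row_block EA EB EC ED.
by rewrite -!raddfD acE bdE row_mx_const.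
Qed.

Lemma mul_const_mx22 (R : realFieldType) (x a b c d y : R) :
  x * (a + c) = y -> x * (b + d) = y ->
  const_mx x *m mx22 a b c d = const_mx y :> 'rV_2.
Proof.
rewrite !mulrDr => acE bdE.
by apply: (@mul_const_block _ 1 1 1 1 _ _ _ _ _ _ _ _ _ _ _ _ _ _ acE bdE);
  rewrite mul_mx_scalar scalemx_const mulrC.
Qed.

(** A constant row is the tensor product of two constant rows, so the product can be taken factor by
    factor; both columns of [sigma] sum to 1. *)
Lemma mul_const_sigma_tens1 (R : realFieldType) (x : R) (K : nat) :
  const_mx x *m sigma_tens1 R K = const_mx x :> 'rV_(pow2 K.+1).
Proof.
(* Eliminating the size equation turns the cast into the identity. *)
rewrite /sigma_tens1; case: _ / (mul2_pow2 K); rewrite castmx_id.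
have tensE : tensmx (const_mx x : 'rV_2) (const_mx 1 : 'rV_(pow2 K)) = const_mx x.
  by apply/matrixP => i j; rewrite !mxE mulr1.
have := tensmx_mul (const_mx x : 'rV_2) (const_mx 1 : 'rV_(pow2 K))
          (sigma R) (1%:M : 'M_(pow2 K)).
rewrite mulmx1 (@mul_const_mx22 _ _ _ _ _ _ x) ?add0r ?addr0 ?mulr1 //.
by rewrite tensE.
Qed.

(** The factor [alpha] in the second sum cancels [alpha^-1] in the recursion; both block columns of
    each new matrix then add up to twice the previous sum. *)
Lemma transfer_blocks_colsum (R : realFieldType) (alpha beta : R) (K : nat) :
  alpha != 0 ->
  let T := transfer_blocks alpha beta K.+1 in
  const_mx 1 *m T.1 = const_mx (2 ^+ K * (1 + alpha) * (1 + beta)) :> 'rV_(_) /\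
  const_mx 1 *m T.2 = const_mx (2 ^+ K * alpha * (1 + beta)) :> 'rV_(_).
Proof.
move=> alpha_neq0; elim: K => [|K [IH1 IH2]].
  by split; apply: mul_const_mx22; ring.
set T := transfer_blocks alpha beta K.+1 in IH1 IH2.
have IHs : const_mx 1 *m (T.2 *m sigma_tens1 R K) =
    const_mx (2 ^+ K * alpha * (1 + beta)) :> 'rV_(_).
  by rewrite mulmxA IH2 mul_const_sigma_tens1.
split; apply: mul_const_block;
  rewrite -/T ?mulmxDr -?scalemxAr ?IHs ?IH1 ?IH2 ?scalemx_const -?raddfD.
(* The four block sums are still open; closing these goals determines them and leaves only scalar
   identities. The zero block is read as [const_mx 0]. *)
all: try by rewrite ?mulmx0 -?(raddf0 const_mx).
all: by rewrite exprS; field.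
Qed.

Lemma transfer_colsum (R : realFieldType) (alpha beta : R) (K : nat) :
  alpha != 0 ->
  const_mx 1 *m transfer alpha beta K.+1 =
    const_mx (2 ^+ K * (1 + 2 * alpha) * (1 + beta)) :> 'rV_(_).
Proof.
move=> /(transfer_blocks_colsum beta K) [E1 E2].
rewrite -row_mx_const mul_row_col E1 E2 -raddfD.
by congr const_mx; ring.
Qed.

Lemma partition_functionE (R : realFieldType) (alpha beta : R) (L : nat) :
  partition_function alpha beta L =
    ((const_mx 1 : 'rV_(pow2 L)) *m vstat alpha beta L) 0 0.
Proof. by rewrite mxE; apply: eq_bigr => i _; rewrite mxE mul1r. Qed.

Theorem corollary3 (R : realFieldType) (alpha beta : R) (L : nat)
    (alpha_gt0 : 0 < alpha) (beta_gt0 : 0 < beta) (L_gt0 : (1 <= L)%N) :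
  partition_function alpha beta L =
    2 ^+ 'C(L.-1, 2) * (1 + 2 * alpha) ^+ L.-1 * (1 + beta) ^+ L.-1
      * (2 * alpha + beta).
Proof.
case: L L_gt0 => // L _ /=; elim: L => [|L IH].
  rewrite partition_functionE /= -row_mx_const mul_row_col !mul_mx_scalar.
  by rewrite !mxE; ring.
have step : partition_function alpha beta L.+2 =
    2 ^+ L * (1 + 2 * alpha) * (1 + beta) * partition_function alpha beta L.+1.
  rewrite !partition_functionE [vstat _ _ L.+2]/(transfer _ _ _ *m _).
  rewrite mulmxA transfer_colsum ?gt_eqF //.
  (* The constant row becomes a multiple of the all-ones row, which gives back the previous sum of
     entries. *)
  by rewrite -[X in const_mx X]mulr1 -scalemx_const -scalemxAl mxE.
(* Pascal's rule ['C(L.+1, 2) = 'C(L, 2) + L] absorbs the new factor [2 ^+ L]. *)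
by rewrite step IH binS bin1 exprD !exprS; ring.
Qed.
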